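(* For every positive integer $r$ there exists $n_0(r)$ such that for all $n\ge n_0(r)$ the level $\mathscr{B}_r(n)$ is EKR; that is, the maximum size of an intersecting family $\mathcal{P}\subseteq\mathscr{B}_r(n)$ equals $\max_{p\in\mathscr{B}_1(n)}|\{q\in\mathscr{B}_r(n)\mid p\preceq q\}|$.
   Context: $\mathscr{B}(n)=(\mathrm{Sym}(n),\preceq)$ is the (right) weak Bruhat lattice. A permutation is written $p=p_1p_2\cdots p_n$, meaning $p(i)=p_i$. The order $\preceq$ is generated by the covering relation: $q$ covers $p$ if, for some $i\in\{1,\dots,n-1\}$, $p_i<p_{i+1}$, $q_i=p_{i+1}$, $q_{i+1}=p_i$ and $q_k=p_k$ for all other $k$. The least element is the identity, and rank is distance from the identity. $\mathscr{B}_\ell(n)$ is the set of all permutations of rank $\ell$ in $\mathscr{B}(n)$. A family $\mathcal{P}$ of permutations is intersecting if $\mathrm{rank}(x\wedge y)\ge 1$ for all $x,y\in\mathcal{P}$ (including $x=y$), where $\wedge$ is the meet in $\mathscr{B}(n)$. *)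

(* Defs.v *)
From HB Require Import structures.
From mathcomp Require Import all_boot all_order all_fingroup.
From mathcomp Require Import zify.

Set Implicit Arguments.
Unset Strict Implicit.
Unset Printing Implicit Defensive.

Import Order.TTheory.

(* Distance from x to y in the finite graph with edge relation e. A shortest  *)
(* path is duplicate-free, so its length is less than #|T|; if y is not       *)
(* reachable from x, the value is #|T|.                                       *)
Definition dist (T : finType) (e : rel T) (x y : T) : nat :=
  find (fun k => [exists t : k.-tuple T, path e x t && (last x t == y)])
    (iota 0 #|T|).

Section WeakOrder.
Variable n : nat.
Implicit Types (p q x y z m : 'S_n) (a b c i j k u v : 'I_n).

(* q covers p; one-line notation is 0-indexed, with entries in {0, .., n-1}. *)
Definition covers p q : bool :=
  [exists i : 'I_n, exists j : 'I_n,
    [&& j == i.+1 :> nat, p i < p j, q i == p j, q j == p i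
      & [forall k : 'I_n, (k != i) && (k != j) ==> (q k == p k)]]].

Definition weak_le p q : bool := connect covers p q.

Definition weak_meet x y : 'S_n :=
  odflt 1%g
    [pick m | [forall z : 'S_n, weak_le z m == weak_le z x && weak_le z y]].

Definition weak_join x y : 'S_n :=
  odflt 1%g
    [pick m | [forall z : 'S_n, weak_le m z == weak_le x z && weak_le y z]].

(* Distance is taken in the (undirected) Hasse diagram. *)
Definition rank p : nat :=
  dist (fun x y => covers x y || covers y x) 1%g p.

(* Pairs of values a < b such that a precedes b in one-line notation: p is    *)
(* below q iff every non-inversion of q is a non-inversion of p.              *)
Definition noninv p a b : bool := (a < b) && ((p^-1)%g a < (p^-1)%g b).

Definition inversions p : {set 'I_n * 'I_n} :=
  [set ab : 'I_n * 'I_n | (ab.1 < ab.2) && ((p^-1)%g ab.2 < (p^-1)%g ab.1)].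

Lemma tperm_lt i j u v :
  j = i.+1 :> nat -> u < v -> ~~ ((u == i) && (v == j)) ->
  tperm i j u < tperm i j v.
Proof.
move=> ij uv; rewrite -!val_eqE /= => h.
have ne a b : a <> b -> nat_of_ord a <> nat_of_ord b by move=> + /val_inj.
case: tpermP => [ui|ui|/ne ui /ne uj]; case: tpermP => [vi|vi|/ne vi /ne vj];
  subst; lia.
Qed.

Lemma coversP p q :
  reflect (exists i j, [/\ j = i.+1 :> nat, p i < p j & q = (tperm i j * p)%g])
          (covers p q).
Proof.
apply: (iffP existsP) => -[i].
  case/existsP=> j /and5P[/eqP ij pij /eqP qi /eqP qj /forallP qk].
  exists i, j; split=> //; apply/permP => k; rewrite permM.
  case: tpermP => [->|->|/eqP ki /eqP kj] //.
  by have := qk k; rewrite ki kj /= => /eqP.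
case=> j [ij pij ->]; exists i; apply/existsP; exists j.
rewrite !permM tpermL tpermR ij !eqxx pij /=.
apply/forallP => k; apply/implyP => /andP[ki kj].
by rewrite permM tpermD // eq_sym.
Qed.

Lemma incr_perm (s : 'S_n) : (forall u v, u < v -> s u < s v) -> s = 1%g.
Proof.
have ge (t : 'S_n) : (forall u v, u < v -> t u < t v) -> forall u, u <= t u.
  move=> tlt [u]; elim: u => [//|u IH] hu /=.
  apply: leq_trans (tlt (Ordinal (ltnW hu)) (Ordinal hu) _) => //.
  by rewrite ltnS; apply: IH.
move=> slt; apply/permP => u; rewrite perm1; apply/val_inj/eqP => /=.
rewrite eqn_leq ge // andbT.
have slt' : forall u v, u < v -> (s^-1)%g u < (s^-1)%g v.
  move=> a b ab; rewrite ltnNge; apply/negP; rewrite leq_eqVlt => /orP[|].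
    by move/eqP/val_inj/perm_inj => e; rewrite e ltnn in ab.
  by move/slt; rewrite !permKV; lia.
by have := ge _ slt' (s u); rewrite permK.
Qed.

Lemma noninvC p a b : a < b -> ~~ noninv p a b = ((p^-1)%g b < (p^-1)%g a).
Proof.
move=> ab; rewrite /noninv ab -leqNgt leq_eqVlt; case: eqP => //= /val_inj/perm_inj e.
by rewrite e ltnn in ab.
Qed.

Lemma noninv_inj p q : noninv p =2 noninv q -> p = q.
Proof.
move=> e; suff: (p * q^-1)%g = 1%g by move/(canRL (mulgKV _)); rewrite mul1g.
apply: incr_perm => u v uv; rewrite !permM.
case: (ltngtP (p u) (p v)) => [puv|puv|/val_inj/perm_inj E]; last by rewrite E ltnn in uv.
  by have := e (p u) (p v); rewrite /noninv puv !permK uv /= => <-.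
have := noninvC p puv; rewrite !permK uv e => h.
by rewrite -(noninvC q puv) h.
Qed.

Lemma covers_noninv p q : covers p q -> forall a b, noninv q a b -> noninv p a b.
Proof.
case/coversP=> i [j [ij pij ->]] a b; rewrite /noninv => /andP[ab].
rewrite ab invMg tpermV !permM => h.
have := tperm_lt ij h; rewrite !tpermK; apply; apply/negP => /andP[/eqP e1 /eqP e2].
have E1 : a = p j.
  by apply: (canRL (permKV p)); apply: (can_inj (tpermK i j)); rewrite e1 tpermR.
have E2 : b = p i.
  by apply: (canRL (permKV p)); apply: (can_inj (tpermK i j)); rewrite e2 tpermL.
by rewrite E1 E2 in ab; lia.
Qed.

Lemma covers_inversions p q : covers p q -> #|inversions q| = #|inversions p|.+1.
Proof.
move=> pq; have := covers_noninv pq; case/coversP: pq => i [j [ij pij qE]] sub.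
have -> : inversions q = (p i, p j) |: inversions p.
  apply/setP => -[a b]; rewrite !inE /=.
  case: (ltnP a b) => ab /=; last first.
    by rewrite orbF; apply/esym/negP => /eqP[E1 E2]; rewrite E1 E2 in ab; lia.
  rewrite -!noninvC // ; case: eqP => [[-> ->]|ne] /=.
    by rewrite /noninv qE invMg tpermV !permM !permK tpermL tpermR; lia.
  congr (~~ _); apply/idP/idP; first exact: sub.
  rewrite /noninv ab qE invMg tpermV !permM /= => h.
  apply: tperm_lt => //; apply/negP => /andP[/eqP e1 /eqP e2]; apply: ne.
  by rewrite -e1 -e2 !permKV.
rewrite cardsU1 !inE /= !permK; lia.
Qed.

Lemma weak_leP p q :
  reflect (forall a b, noninv q a b -> noninv p a b) (weak_le p q).
Proof.
apply: (iffP idP) => [/connectP[s]|].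
  elim: s p => [|r s IH] p /=; first by move=> _ ->.
  by case/andP=> pr rs e a b /(IH _ rs e); apply: covers_noninv.
have [N] := ubnP (#|[set ab : 'I_n * 'I_n | noninv p ab.1 ab.2]|).
elim: N p => // N IH p pN sub.
case: (boolP [exists i : 'I_n, exists j : 'I_n,
   [&& j == i.+1 :> nat, p i < p j & ~~ noninv q (p i) (p j)]]).
  case/existsP=> i /existsP[j /and3P[/eqP ij pij nq]].
  set r := (tperm i j * p)%g.
  have pr : covers p r by apply/coversP; exists i, j.
  apply: (connect_trans (connect1 pr)); apply: IH.
    move: pN; rewrite ltnS; apply: leq_trans; apply/proper_card/properP; split.
      by apply/subsetP=> -[a b]; rewrite !inE; apply: (covers_noninv pr).
    exists (p i, p j); rewrite !inE /= /noninv pij /=; first by rewrite !permK ij.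
    by rewrite /r invMg tpermV !permM !permK tpermL tpermR; lia.
  move=> a b qab; have := sub _ _ qab; rewrite /noninv => /andP[ab h].
  rewrite ab /r invMg tpermV !permM /=; apply: tperm_lt => //.
  apply/negP => /andP[/eqP e1 /eqP e2]; move: nq.
  by rewrite -e1 -e2 !permKV qab.
rewrite negb_exists => /forallP noa.
have step i j : j = i.+1 :> nat -> (q^-1)%g (p i) < (q^-1)%g (p j).
  move=> ij; case: (ltngtP (p i) (p j)) => [pij|pij|/val_inj/perm_inj E].
  - have := noa i; rewrite negb_exists => /forallP/(_ j).
    by rewrite ij eqxx pij /= negbK => /andP[].
  - rewrite -noninvC //; apply/negP => /sub; rewrite /noninv !permK; lia.
  - by rewrite E in ij; lia.
suff -> : p = q by exact: connect0.
suff: (p * q^-1)%g = 1%g by move/(canRL (mulgKV _)); rewrite mul1g.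
apply: incr_perm => u [v hv] /=; elim: v hv => // v IHv hv uv.
have hv' := ltnW hv; have := step (Ordinal hv') (Ordinal hv) erefl.
rewrite !permM; move: uv; rewrite ltnS leq_eqVlt => /orP[/eqP e|].
  by have -> : u = Ordinal hv' by apply: val_inj.
by move/(IHv hv'); rewrite !permM; apply: ltn_trans.
Qed.

Lemma weak_le_refl : reflexive weak_le. Proof. exact: connect0. Qed.
Lemma weak_le_trans : transitive weak_le. Proof. exact: connect_trans. Qed.
Lemma weak_le_anti : antisymmetric weak_le.
Proof.
move=> p q /andP[/weak_leP pq /weak_leP qp]; apply: noninv_inj => a b.
by apply/idP/idP; [apply: qp | apply: pq].
Qed.

Lemma order_perm (L : rel 'I_n) : irreflexive L -> transitive L ->
  (forall a b, a != b -> L a b || L b a) ->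
  exists m, forall a b, ((m^-1)%g a < (m^-1)%g b) = L a b.
Proof.
move=> Lirr Ltr Ltot.
have lt a : #|[set b | L b a]| < n.
  rewrite -[n in _ < n]card_ord -cardsT; apply/proper_card/properP; split.
    exact/subsetP.
  by exists a; rewrite !inE ?Lirr.
pose f a := Ordinal (lt a).
have fL a b : L a b -> f a < f b.
  move=> ab; apply/proper_card/properP; split.
    by apply/subsetP=> c; rewrite !inE => /Ltr; apply.
  by exists a; rewrite !inE ?Lirr.
have finj : injective f.
  move=> a b e; apply/eqP/negPn/negP => /Ltot /orP[] /fL; rewrite e; lia.
exists (perm finj)^-1%g => a b; rewrite invgK !permE; apply/idP/idP; last exact: fL.
move=> h; have : a != b by apply/negP => /eqP e; move: h; rewrite e ltnn.
by case/Ltot/orP => // /fL; lia.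
Qed.

Lemma weak_meet_ex x y :
  exists m, forall z, weak_le z m = weak_le z x && weak_le z y.
Proof.
pose U a b := noninv x a b || noninv y a b.
have le a b : connect U a b -> a <= b.
  case/connectP=> s + ->; elim: s a => //= c s IH a /andP[h /IH]; apply: leq_trans.
  by case/orP: h => /andP[/ltnW].
have btw a b c : a < b -> b < c -> connect U a c -> connect U a b || connect U b c.
  move=> ab bc /connectP[s]; elim: s a ab => [|d s IH] a ab /=; first by move=> _ e; move: bc; rewrite e; lia.
  case/andP=> ad ds ce.
  have dc : connect U d c by apply/connectP; exists s.
  case: (ltngtP d b) => [db|bd|/val_inj E].
  - case/orP: (IH d db ds ce) => [h|->]; last by rewrite orbT.
    by rewrite (connect_trans (connect1 ad) h).
  - have [w [wU wad]] : exists w, (forall e f, noninv w e f -> U e f) /\ noninv w a d.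
      by case/orP: ad => h; [exists x | exists y]; split=> // e f hh; rewrite /U hh ?orbT.
    case/andP: wad => _ wad; case: (ltnP ((w^-1)%g a) ((w^-1)%g b)) => h.
      by rewrite connect1 //; apply: wU; rewrite /noninv ab.
    rewrite (connect_trans _ dc) ?orbT // connect1 //; apply: wU.
    by rewrite /noninv bd; apply: leq_ltn_trans wad.
  - by rewrite -E connect1.
have tr a b c : connect U a b -> connect U b c -> connect U a c.
  exact: connect_trans.
pose L a b := if a < b then connect U a b else (b < a) && ~~ connect U b a.
have Lirr : irreflexive L by move=> a; rewrite /L ltnn.
have Ltot a b : a != b -> L a b || L b a.
  rewrite /L -val_eqE /=; case: ltngtP => //= _ _; [exact: orbN | exact: orNb].
have Lasym a b : L a b -> ~~ L b a.
  by rewrite /L; case: ltngtP => //= _; rewrite ?negbK.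
have Ltr : transitive L.
  move=> b a c; case: (altP (a =P c)) => [<- h /(negP (Lasym _ _ h)) //|].
  rewrite -val_eqE /L /=.
  have abc := btw a b c; have acb := btw a c b; have bac := btw b a c.
  have bca := tr b c a; have cab := tr c a b; have cba := btw c b a.
  have tabc := tr a b c.
  move: abc acb bac bca cab cba tabc.
  case: (ltngtP a b) => //= ?; case: (ltngtP b c) => //= ?;
    case: (ltngtP a c) => //= ?; do ?[lia];
  do 6?[case: connect => //=]; intuition.
have [m mL] := order_perm Lirr Ltr Ltot.
have mE a b : noninv m a b = (a < b) && connect U a b.
  by rewrite /noninv mL /L; case: (a < b).
exists m => z; apply/weak_leP/andP => [zm|[/weak_leP zx /weak_leP zy] a b].
  split; apply/weak_leP => a b h; apply: zm; rewrite mE connect1 /U ?h ?orbT // andbT;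
  by case/andP: h.
rewrite mE => /andP[ab /connectP[s + e]]; move: ab; rewrite e {e}.
have zU c d : U c d -> noninv z c d by case/orP; [apply: zx | apply: zy].
elim: s a => [|c s IH] a /=; first by rewrite ltnn.
move=> _ /andP[/zU ac cs]; have cl : connect U c (last c s) by apply/connectP; exists s.
move: (le _ _ cl); rewrite leq_eqVlt => /orP[/eqP/val_inj <- //|lt].
have := IH c lt cs; case/andP: ac => ac ac' /andP[cd cd'].
by rewrite /noninv (ltn_trans ac cd) (ltn_trans ac' cd').
Qed.

Lemma weak_join_ex x y :
  exists m, forall z, weak_le m z = weak_le x z && weak_le y z.
Proof.
pose w0 : 'S_n := perm (@rev_ord_inj n).
have w0w0 : (w0 * w0)%g = 1%g.
  by apply/permP=> a; rewrite permM !permE rev_ordK.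
have rvE p a b : noninv (w0 * p) a b = (a < b) && ~~ noninv p a b.
  case: (ltnP a b) => ab /=; last by rewrite /noninv ltnNge ab.
  rewrite noninvC // /noninv ab /= invMg !permM.
  have -> : w0^-1%g = w0 by apply/eqP; rewrite eq_invg_mul w0w0.
  move: (p^-1)%g => p1; rewrite 2!(permE (@rev_ord_inj n)) /=.
  by have := ltn_ord (p1 a); have := ltn_ord (p1 b); lia.
have rvK p : (w0 * (w0 * p))%g = p by rewrite mulgA w0w0 mul1g.
have anti p q : weak_le p q -> weak_le (w0 * q)%g (w0 * p)%g.
  move/weak_leP=> h; apply/weak_leP => a b; rewrite !rvE => /andP[-> /=].
  by apply: contra => /h.
have antiE p q : weak_le p q = weak_le (w0 * q)%g (w0 * p)%g.
  by apply/idP/idP; first exact: anti; move/anti; rewrite !rvK.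
have [m mP] := weak_meet_ex (w0 * x)%g (w0 * y)%g.
by exists (w0 * m)%g => z; rewrite antiE rvK mP -!antiE.
Qed.

Lemma weak_meetP x y z : weak_le x (weak_meet y z) = weak_le x y && weak_le x z.
Proof.
rewrite /weak_meet; case: pickP => [m /forallP/(_ x)/eqP //|no].
have [m mP] := weak_meet_ex y z; have /negP[] := no m.
by apply/forallP => w; rewrite mP.
Qed.

Lemma weak_joinP x y z : weak_le (weak_join x y) z = weak_le x z && weak_le y z.
Proof.
rewrite /weak_join; case: pickP => [m /forallP/(_ z)/eqP //|no].
have [m mP] := weak_join_ex x y; have /negP[] := no m.
by apply/forallP => w; rewrite mP.
Qed.

Lemma weak_le1 p : weak_le 1%g p.
Proof.
by apply/weak_leP => a b /andP[ab _]; rewrite /noninv invg1 !perm1 ab.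
Qed.

Lemma rankE p : rank p = #|inversions p|.
Proof.
pose e x y := covers x y || covers y x.
have inv1 : #|inversions 1%g| = 0.
  by apply: eq_card0 => -[a b]; rewrite !inE /= invg1 !perm1; lia.
pose Q (k : nat) := [exists t : k.-tuple 'S_n, path e 1%g t && (last 1%g t == p)].
have lower (k : nat) : Q k -> #|inversions p| <= k.
  case/existsP=> t /andP[pt /eqP <-]; rewrite -[k in _ <= k](size_tuple t).
  suff h (s : seq 'S_n) (x : 'S_n) : path e x s ->
      #|inversions (last x s)| <= #|inversions x| + size s.
    by have := h t 1%g pt; rewrite inv1.
  elim: s x => [|y s IH] x /=; first by rewrite addn0.
  case/andP=> /orP[] /covers_inversions xy /IH h; apply: (leq_trans h).
    by rewrite xy addSnnS.
  by rewrite xy leq_add // ltnW.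
have [s [s1 s2 s3]] : exists s : seq 'S_n,
    [/\ path covers 1%g s, p = last 1%g s & uniq (1%g :: s)].
  case/connectP: (weak_le1 p) => s1 h; case/shortenP: h => s' h u _ e1.
  by exists s'.
have sz : size s = #|inversions p|.
  suff h (x : 'S_n) : path covers x s ->
      #|inversions (last x s)| = #|inversions x| + size s.
    by rewrite s2 h // inv1.
  elim: s x {s1 s2 s3} => [|y s IH] x /=; first by rewrite addn0.
  by case/andP=> /covers_inversions xy /IH ->; rewrite xy addSnnS.
have upper : Q #|inversions p|.
  rewrite -sz; apply/existsP; exists (in_tuple s); rewrite /= -s2 eqxx andbT.
  by apply: sub_path s1 => x y xy; rewrite /e xy.
have lt : #|inversions p| < #|{perm 'I_n}|.
  by rewrite -sz -/(size (1%g :: s)) -(card_uniqP s3) max_card.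
rewrite /rank /dist -/e -/Q.
have hQ : has Q (iota 0 #|{perm 'I_n}|).
  by apply/hasP; exists #|inversions p|; rewrite // mem_iota.
apply/eqP; rewrite eqn_leq; apply/andP; split.
  rewrite leqNgt; apply/negP => /(before_find 0).
  by rewrite nth_iota // add0n upper.
have := nth_find 0 hQ; rewrite nth_iota ?add0n => [/lower //|].
by move: hQ; rewrite has_find size_iota.
Qed.

End WeakOrder.

Definition weak_bruhat (n : nat) : Type := 'S_n.

Fact weak_bruhat_display : Order.disp_t. Proof. exact: Order.Disp tt tt. Qed.

HB.instance Definition _ (n : nat) := Finite.on (weak_bruhat n).
HB.instance Definition _ (n : nat) :=
  Order.Le_isPOrder.Build weak_bruhat_display (weak_bruhat n)
    (@weak_le_refl n) (@weak_le_anti n) (@weak_le_trans n).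
HB.instance Definition _ (n : nat) :=
  Order.POrder_MeetJoin_isLattice.Build weak_bruhat_display (weak_bruhat n)
    (@weak_meetP n) (@weak_joinP n).

Definition level (l n : nat) : {set weak_bruhat n} := [set p | rank p == l].

Definition intersecting (n : nat) (P : {set weak_bruhat n}) : bool :=
  [forall x in P, forall y in P, 1 <= rank (x `&` y)%O].

Definition EKR (r n : nat) : Prop :=
  \max_(P : {set weak_bruhat n} | (P \subset level r n) && intersecting P) #|P|
  = \max_(p in level 1 n) #|[set q in level r n | (p <= q)%O]|.

(* Main.v *)
Require Import Defs.
From mathcomp Require Import all_boot all_order all_fingroup.
From mathcomp Require Import zify.

(* An intersecting family meets pairwise in the left descent sets             *)
(* D(q) = {i : i+1 precedes i in q}, because the atom s_i is below q iff i is *)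
(* in D(q). If a family in level r has no common descent, then each member    *)
(* contains one of at most r^2 pairs of distinct descents (impossible for     *)
(* r = 1), and removing such a pair by swapping values injects the            *)
(* corresponding members into level r-2; so the family has size at most       *)
(* r^2 I(r-2), with I(k) the size of level k. The swap of i and i+1 exchanges *)
(* permutations with and without descent i, so every star satisfies           *)
(* star(k+1) + star(k) = I(k), whence star(r) >= I(r-1) - I(r-2). Summing     *)
(* this identity over i bounds (n-1) I(k) by (k+1) I(k+1) + k I(k), so        *)
(* I(r-1) / I(r-2) grows at least linearly with n and stars win for large n.  *)

Set Implicit Arguments.
Unset Strict Implicit.
Unset Printing Implicit Defensive.

Import Order.TTheory.

(** An intersecting family lies in a star or is small. [intersecting_descents] turns intersection
    into shared left descents; [card_no_common_descent] bounds a family without a common descent by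
    r^2 I(r-2); [leq_card_star] shows that stars are at least that large once n >= r(r^2 + 2);
    [atom_star] identifies stars with the up-sets of atoms inside the level. *)

Lemma leq_card_cover (T I : finType) (P : {set T}) (S : {set I})
    (F : I -> {set T}) m :
  (forall x, x \in P -> exists2 i, i \in S & x \in F i) ->
  (forall i, i \in S -> #|P :&: F i| <= m) -> #|P| <= #|S| * m.
Proof.
move=> cov Fm; rewrite -sum_nat_const.
apply: (@leq_trans (\sum_(i in S) #|P :&: F i|)); last exact: leq_sum.
under eq_bigr => i _ do rewrite -sum1_card big_mkcond /=.
rewrite exchange_big /= -sum1_card big_mkcond /=; apply: leq_sum => x _.
case: ifP => // /[dup] xP /cov[i iS xi].
by rewrite (bigD1 i) //= inE xP xi.
Qed.

Section Descents.
Variable n : nat.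
Implicit Types (p q x y : 'S_n) (ab cd : 'I_n * 'I_n).

Definition adjacent : {set 'I_n * 'I_n} :=
  [set ab : 'I_n * 'I_n | ab.2 == ab.1.+1 :> nat].

Definition descents p : {set 'I_n * 'I_n} := inversions p :&: adjacent.

Definition swap ab : 'S_n := tperm ab.1 ab.2.

Definition layer k : {set 'S_n} := [set p | rank p == k].

Definition star ab k : {set 'S_n} := [set p in layer k | ab \in descents p].

Lemma in_descents p ab : ab \in adjacent ->
  (ab \in descents p) = ((p^-1)%g ab.2 < (p^-1)%g ab.1).
Proof. by rewrite !inE => /eqP e; rewrite e ltnSn eqxx andbT. Qed.

Lemma leq_card_adjacent : n.-1 <= #|adjacent|.
Proof.
have lt (k : 'I_n.-1) : k.+1 < n by have := ltn_ord k; lia.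
rewrite -[n.-1]card_ord; pose f k := (widen_ord (leq_pred n) k, Ordinal (lt k)).
have finj : injective f by move=> i j [/val_inj].
rewrite -(card_codom finj); apply/subset_leq_card/subsetP => _ /codomP[k ->].
by rewrite inE /=.
Qed.

(** Inversions of p by value correspond to those of its inverse by position. This lets [rank_swap]
    treat a swap of values as a cover, which swaps positions. *)
Lemma rankV p : rank (p^-1)%g = rank p.
Proof.
have le q : rank q <= rank (q^-1)%g.
  rewrite !rankE; pose f ab := ((q^-1)%g ab.2, (q^-1)%g ab.1).
  have finj : injective f.
    by move=> [a b] [c d] [/perm_inj e1 /perm_inj e2]; rewrite e1 e2.
  rewrite -(card_imset _ finj); apply/subset_leq_card/subsetP => _ /imsetP[[a b] + ->].
  by rewrite !inE /= => /andP[ab h]; rewrite invgK !permKV h.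
by apply/eqP; rewrite eqn_leq le -[in X in _ <= X](invgK p) le.
Qed.

Lemma descents_swap p ab : ab \in adjacent ->
  (ab \in descents (p * swap ab)%g) = (ab \notin descents p).
Proof.
move=> abA; rewrite !in_descents // invMg tpermV !permM tpermL tpermR.
case: (ltngtP _ _) => // /val_inj/perm_inj e.
by move: abA; rewrite inE e; lia.
Qed.

Lemma rank_swap p ab : ab \in adjacent -> ab \notin descents p ->
  rank (p * swap ab)%g = (rank p).+1.
Proof.
move=> abA; rewrite -descents_swap // in_descents // invMg tpermV !permM.
rewrite tpermL tpermR => h; rewrite -[LHS]rankV -[in RHS]rankV !rankE.
apply: covers_inversions; apply/coversP; exists ab.1, ab.2; split=> //.
  by move: abA; rewrite inE => /eqP.
by rewrite invMg tpermV.
Qed.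

Lemma swapK ab p : (p * swap ab * swap ab)%g = p.
Proof. by rewrite -mulgA tperm2 mulg1. Qed.

Lemma rank_swap_descent p ab : ab \in descents p ->
  rank p = (rank (p * swap ab)%g).+1.
Proof.
move=> h; have abA : ab \in adjacent by case/setIP: h.
by rewrite -(rank_swap abA) ?swapK // -descents_swap // swapK.
Qed.

Lemma card_descents_le p : #|descents p| <= rank p.
Proof. by rewrite rankE subset_leq_card // subsetIl. Qed.

Lemma weak_le_inversions p q : weak_le p q = (inversions p \subset inversions q).
Proof.
apply/weak_leP/subsetP => [h [a b]|h a b].
  rewrite !inE /= => /andP[ab]; rewrite ab -!noninvC //; exact/contra/h.
case: (ltnP a b) => ab; last by rewrite /noninv ltnNge ab.
apply: contraLR; rewrite !noninvC // => np; have := h (a, b).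
by rewrite !inE /= ab np; apply.
Qed.

(* The inverse of a permutation without descents is increasing. *)
Lemma rank_gt0 p : 0 < rank p -> exists ab, ab \in descents p.
Proof.
move=> rp; apply/set0Pn/eqP => d0; suff p1 : p = 1%g.
  move: rp; rewrite p1 rankE card_gt0 => /set0Pn[[a b]].
  by rewrite !inE invg1 !perm1 /=; lia.
suff: (p^-1 = 1)%g by move/(canRL invgK) ->; rewrite invg1.
apply: incr_perm => u [v hv] /=; elim: v hv => // v IHv hv uv.
have hv' := ltnW hv.
have step : (p^-1)%g (Ordinal hv') < (p^-1)%g (Ordinal hv).
  have abA : (Ordinal hv', Ordinal hv) \in adjacent by rewrite inE.
  have := descents_swap p abA; rewrite d0 in_set0 in_descents //.
  by rewrite invMg tpermV !permM tpermL tpermR.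
move: uv; rewrite ltnS leq_eqVlt => /orP[/eqP e|].
  by have -> : u = Ordinal hv' by apply: val_inj.
by move/(IHv hv')/ltn_trans; apply.
Qed.

Lemma card_star_le ab k : ab \in adjacent -> #|star ab k.+1| <= #|layer k|.
Proof.
move=> abA; rewrite -(card_imset _ (@mulIg _ (swap ab))).
apply/subset_leq_card/subsetP => _ /imsetP[p + ->].
by case/setIdP=> + h; rewrite !inE (rank_swap_descent h) eqSS.
Qed.

(** Members of the layer with descent [ab] form [star ab k]; swapping injects the others into
    [star ab k.+1]. *)
Lemma leq_card_layer ab k : ab \in adjacent ->
  #|layer k| <= #|star ab k.+1| + #|star ab k|.
Proof.
move=> abA; rewrite addnC -(cardsID [set p | ab \in descents p]).
apply: leq_add.
  by apply/subset_leq_card/subsetP => p; rewrite !inE.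
rewrite -(card_imset _ (@mulIg _ (swap ab))).
apply/subset_leq_card/subsetP => _ /imsetP[p + ->].
case/setDP=> + /[1!inE] h; rewrite inE => rp; apply/setIdP.
by rewrite descents_swap // inE rank_swap // eqSS.
Qed.

(** Double counting of pairs (permutation, descent): a permutation of rank k has at most k
    descents. *)
Lemma sum_card_star k : \sum_(ab in adjacent) #|star ab k| <= #|layer k| * k.
Proof.
under eq_bigr => ab _ do rewrite -sum1dep_card.
rewrite (exchange_big_dep (mem (layer k))) /=; last by move=> ab p _ /andP[].
rewrite -sum_nat_const; apply: leq_sum => p pk.
have rp : rank p = k by move: pk; rewrite inE => /eqP.
rewrite -rp; apply: leq_trans (card_descents_le p); rewrite sum1dep_card.
by apply/subset_leq_card/subsetP => ab; rewrite !inE => /and3P[_ _].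
Qed.

Lemma leq_card_layerS k :
  n.-1 * #|layer k| <= #|layer k.+1| * k.+1 + #|layer k| * k.
Proof.
apply: leq_trans (leq_add (sum_card_star k.+1) (sum_card_star k)).
rewrite -big_split /=.
apply: (@leq_trans (\sum_(ab in adjacent) #|layer k|)).
  by rewrite sum_nat_const leq_mul2r leq_card_adjacent orbT.
by apply: leq_sum => ab; apply: leq_card_layer.
Qed.

Lemma descents_swap_neq p ab cd : ab != cd ->
  ab \in descents p -> cd \in descents p -> cd \in descents (p * swap ab)%g.
Proof.
move=> ne h1 h2; have [_ abA] := setIP h1; have [_ cdA] := setIP h2.
move: h1 h2; rewrite !in_descents // invMg tpermV !permM /swap.
case: ab cd ne abA cdA => [a b] [c d]; rewrite xpair_eqE -!val_eqE !inE /=.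
move=> ne /eqP ab /eqP cd h1 h2.
(* If the two pairs share a value, the three consecutive values occur in decreasing order, so the
   descent survives by transitivity. *)
case: (tpermP a b c) => [E|E|_ _]; case: (tpermP a b d) => [F|F|_ _]; subst;
  by [exact: h2 | lia | exact: ltn_trans h1 _ | exact: ltn_trans h2 _].
Qed.

(** Swapping [ab] lowers the rank by one and keeps the descent [cd]; swapping [cd] then lowers it
    again. *)
Lemma card_star2_le ab cd k : ab != cd ->
  #|star ab k.+2 :&: star cd k.+2| <= #|layer k|.
Proof.
move=> ne; case: (boolP (cd \in adjacent)) => [cdA|cdA]; last first.
  rewrite (_ : _ :&: _ = set0) ?cards0 //; apply/setP => p.
  rewrite in_set0; apply/negP => /setIP[_ /setIdP[_ /setIP[_ h]]].
  by rewrite h in cdA.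
apply: leq_trans (card_star_le k cdA); rewrite -(card_imset _ (@mulIg _ (swap ab))).
apply/subset_leq_card/subsetP => _ /imsetP[p + ->].
case/setIP=> /setIdP[rp h1] /setIdP[_ h2].
apply/setIdP; split; last exact: descents_swap_neq.
by move: rp; rewrite !inE (rank_swap_descent h1) eqSS.
Qed.

Lemma card_no_common_descent (P : {set 'S_n}) k :
  P \subset layer k.+2 ->
  (forall x y, x \in P -> y \in P -> exists ab, ab \in descents x :&: descents y) ->
  (forall ab, exists2 x, x \in P & ab \notin descents x) ->
  #|P| <= k.+2 * (k.+2 * #|layer k|).
Proof.
move=> /subsetP Pk PI Pno; have [->|[x xP]] := set_0Vmem P; first by rewrite cards0.
have lerk y : y \in P -> #|descents y| <= k.+2.
  by move=> /Pk; rewrite inE => /eqP <-; apply: card_descents_le.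
apply: (@leq_trans (#|descents x| * (k.+2 * #|layer k|))); last first.
  by rewrite leq_mul2r lerk ?orbT.
apply: (leq_card_cover (F := star^~ k.+2)) => [y yP|ab abx].
  have [ab /setIP[abx aby]] := PI _ _ xP yP.
  by exists ab => //; apply/setIdP; split; first exact: Pk.
(* Members with descent [ab] must also share a descent with [z], and it differs from [ab] since [z]
   lacks [ab]. *)
have [z zP abz] := Pno ab.
apply: (@leq_trans (#|descents z| * #|layer k|)); last first.
  by rewrite leq_mul2r lerk ?orbT.
apply: (leq_card_cover (F := star^~ k.+2)) => [y /setIP[yP _]|cd cdz].
  have [cd /setIP[cdz cdy]] := PI _ _ zP yP.
  by exists cd => //; apply/setIdP; split; first exact: Pk.
apply: leq_trans (_ : #|star ab k.+2 :&: star cd k.+2| <= _).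
  by rewrite -setIA subset_leq_card ?subsetIr.
by apply: card_star2_le; apply: contraNneq abz => ->.
Qed.

End Descents.

Lemma leq_card_star n (ab : 'I_n * 'I_n) k :
  k.+2 * (k.+2 * k.+2 + 2) <= n -> ab \in adjacent n ->
  k.+2 * (k.+2 * #|layer n k|) <= #|star ab k.+2|.
Proof.
move=> hn abA.
have h1 := leq_card_layer k.+1 abA; have h2 := card_star_le k abA.
have h3 := leq_card_layerS n k.
suff h4 : (k.+2 * k.+2).+1 * #|layer n k| <= #|layer n k.+1|.
  by move: h4; rewrite mulSn mulnA; lia.
(* With r = k+2, this reduces the claim to (r^2 + 1)(k + 1) + k <= n - 1, which [hn] provides. *)
rewrite -(leq_pmul2r (ltn0Sn k)) -(leq_add2r (#|layer n k| * k)).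
apply: leq_trans h3; rewrite mulnAC [#|_| * k]mulnC -mulnDl leq_mul2r.
by apply/orP; right; nia.
Qed.

(** The atom is the identity with the values [ab] swapped: its only inversion is [ab], so lying
    above it means having [ab] as an inversion. *)
Lemma atom_star n (ab : 'I_n * 'I_n) r : ab \in adjacent n ->
  exists2 p : weak_bruhat n, p \in level 1 n
    & star ab r = [set q in level r n | (p <= q)%O].
Proof.
move=> abA; have rank1 : rank (1 : 'S_n)%g = 0.
  by rewrite rankE; apply: eq_card0 => -[a b]; rewrite !inE /= invg1 !perm1; lia.
have ab1 : ab \notin descents (1 : 'S_n)%g.
  have := card_descents_le (1 : 'S_n)%g; rewrite rank1 leqn0 cards_eq0 => /eqP ->.
  by rewrite inE.
have rp := rank_swap abA ab1; have := descents_swap 1%g abA.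
move: (1 * _)%g rp => p; rewrite rank1 ab1 => rp abp.
exists p; first by rewrite inE rp.
have inv1 : inversions p = [set ab].
  apply/eqP; rewrite eq_sym eqEcard cards1 -rankE rp leqnn andbT sub1set.
  by case/setIP: abp.
apply/setP => q; rewrite 2![in LHS]inE 2![in RHS]inE; congr (_ && _).
rewrite -[RHS]/(weak_le _ _).
by rewrite weak_le_inversions inv1 sub1set inE abA andbT.
Qed.

(** The meet has positive rank, hence a descent, which both elements above it inherit as an
    inversion. *)
Lemma intersecting_descents n (P : {set weak_bruhat n}) : intersecting P ->
  forall x y, x \in P -> y \in P ->
  exists ab, ab \in descents (x : 'S_n) :&: descents (y : 'S_n).
Proof.
move=> /forall_inP PI x y xP yP.
have /forall_inP/(_ y yP)/rank_gt0[ab /setIP[abi abA]] := PI x xP.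
have sub (z : weak_bruhat n) : ((x `&` y)%O <= z)%O -> ab \in descents (z : 'S_n).
  rewrite -[(_ <= _)%O]/(weak_le _ _) weak_le_inversions => /subsetP h.
  by rewrite inE abA andbT; apply: h.
by exists ab; rewrite inE !sub ?leIl ?leIr.
Qed.

Lemma intersecting_star n (p : weak_bruhat n) r : p \in level 1 n ->
  intersecting [set q in level r n | (p <= q)%O].
Proof.
rewrite inE => /eqP rp; apply/forall_inP => x /setIdP[_ px].
apply/forall_inP => y /setIdP[_ py].
have : (p <= x `&` y)%O by rewrite lexI px.
rewrite -[(_ <= _)%O]/(weak_le _ _) weak_le_inversions => /subset_leq_card.
by rewrite -!rankE rp.
Qed.

Theorem theorem5p8 :
  forall r : nat, 0 < r ->
  exists n0 : nat, forall n : nat, n0 <= n -> EKR r n.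
Proof.
move=> r r0; exists (r * (r * r + 2)) => n hn; apply/eqP; rewrite eqn_leq.
apply/andP; split; last first.
  apply/bigmax_leqP => p p1.
  apply: (leq_bigmax_cond [set q in level r n | (p <= q)%O]).
  rewrite intersecting_star // andbT; apply/subsetP => q.
  by case/setIdP.
apply/bigmax_leqP => P /andP[Pr /intersecting_descents PI].
have starle ab : ab \in adjacent n -> #|star ab r| <=
    \max_(p in level 1 n) #|[set q in level r n | (p <= q)%O]|.
  by case/(atom_star r) => p p1 ->; apply: (leq_bigmax_cond p).
have [->|[x xP]] := set_0Vmem P; first by rewrite cards0.
have [ab /setIP[abx _]] := PI _ _ xP xP.
have abA : ab \in adjacent n by case/setIP: abx.
case: (boolP [exists cd, [forall y in P, cd \in descents (y : 'S_n)]]).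
  case/existsP=> cd /forall_inP cdP.
  have cdA : cd \in adjacent n by case/setIP: (cdP _ xP).
  apply: leq_trans (starle cd cdA); apply/subset_leq_card/subsetP => y yP.
  by apply/setIdP; split; [apply: (subsetP Pr) | apply: cdP].
move=> nocommon; have Pno cd : exists2 y, y \in P & cd \notin descents (y : 'S_n).
  by move: nocommon; rewrite negb_exists => /forallP/(_ cd)/forall_inPn.
case: r r0 hn Pr starle => [//|[|k]] _ hn Pr starle.
  (* For r = 1, [ab] is the only descent of [x], so a member [z] without it cannot meet [x]. *)
  have [z zP abz] := Pno ab; have [cd /setIP[cdx cdz]] := PI _ _ xP zP.
  have rx : rank (x : 'S_n) = 1 by have := subsetP Pr _ xP; rewrite inE => /eqP.
  have := card_descents_le (x : 'S_n); rewrite rx => /card_le1P/(_ _ abx) E.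
  by move: cdx cdz abz; rewrite E => /eqP -> ->.
apply: leq_trans (starle ab abA); apply: leq_trans (leq_card_star hn abA).
exact: card_no_common_descent.
Qed.
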